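(* Let $X$ and $Y$ be real Banach spaces with unit spheres $S_X$ and $S_Y$, and let $T: S_X\rightarrow S_Y$ be a surjective isometry. If $X$ has the (T)-property, then $T$ can be extended to a linear surjective isometry from $X$ onto $Y$.
   Context: All spaces are over the real field. For a Banach space $X$, $S_X$ is its unit sphere. For $x\in S_X$, the star of $x$ with respect to $S_X$ is $St(x)=\{y\in S_X : \|y+x\|=2\}$. A convex subset $C$ of $S_X$ is a maximal convex subset of $S_X$ if it is not properly contained in any other convex subset of $S_X$. A Banach space $X$ has the (T)-property if there exists a subset $\{x_\gamma:\gamma\in\Gamma\}$ of $S_X$ such that: (i) for any $\gamma\in\Gamma$, $St(x_\gamma)$ is a maximal convex subset of $S_X$; (ii) $S_X=\bigcup\{St(x_\gamma):\gamma\in\Gamma\}$; (iii) for every $x\in S_X$, $\gamma\in\Gamma$ and $\varepsilon>0$ there exist $x^+_\gamma\in St(x_\gamma)$ and $x^-_\gamma\in St(-x_\gamma)$ such that $\|x-x^+_\gamma\|+\|x-x^-_\gamma\|\leq 2+\varepsilon$. An isometry between unit spheres is a map preserving the norm distance, i.e. $\|T(x)-T(y)\|=\|x-y\|$ for all $x,y\in S_X$. *)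

(* Defs.v *)
From HB Require Import structures.
From mathcomp Require Import all_boot all_order all_algebra.
From mathcomp Require Import all_classical all_reals all_analysis.

Set Implicit Arguments.
Unset Strict Implicit.
Unset Printing Implicit Defensive.

Import Order.TTheory GRing.Theory Num.Theory.
Import numFieldNormedType.Exports.

Local Open Scope classical_set_scope.
Local Open Scope ring_scope.

Definition unit_sphere (R : realType) (X : normedModType R) : set X :=
  [set x | `|x| = 1].
Arguments unit_sphere {R} X.

Definition star (R : realType) (X : normedModType R) (x : X) : set X :=
  [set y | unit_sphere X y /\ `|y + x| = 2].

Definition maximal_convex_subset (R : realType) (X : normedModType R)
    (C : set X) : Prop :=
  [/\ C `<=` unit_sphere X,
      @convex_set R X C &
      forall D : set X, D `<=` unit_sphere X -> @convex_set R X D ->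
        ~ (C `<` D)].

(* The family (x_gamma) is given by its set of values G, since none of the
   three conditions depends on the indexing. *)
Definition T_property (R : realType) (X : normedModType R) : Prop :=
  exists G : set X,
    [/\ G `<=` unit_sphere X,
        forall g, G g -> maximal_convex_subset (star g),
        unit_sphere X = \bigcup_(g in G) star g &
        forall x g (e : R), unit_sphere X x -> G g -> 0 < e ->
          exists xp xm : X,
            [/\ star g xp, star (- g) xm &
                `|x - xp| + `|x - xm| <= 2 + e]].

Definition isometry_on (R : realType) (X Y : normedModType R) (A : set X)
    (f : X -> Y) : Prop :=
  forall x y, A x -> A y -> `|f x - f y| = `|x - y|.

(* Main.v *)
From HB Require Import structures.
Require Import Defs.
From mathcomp Require Import all_boot all_order all_algebra.
From mathcomp Require Import all_classical all_reals all_analysis.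
From mathcomp Require Import ring lra.
Set Implicit Arguments.
Unset Strict Implicit.
Unset Printing Implicit Defensive.

Import Order.TTheory GRing.Theory Num.Theory.
Import numFieldNormedType.Exports.
Local Open Scope classical_set_scope.
Local Open Scope ring_scope.

(** The idea is to carry enough linear functionals from [X] to [Y] through [T].

Let [g] be one of the points given by the (T)-property and let [C] be its star,
a convex set. If [f] is a functional of norm at most 1 that is 1 on [C], it is
-1 on [- C], so [1 - |v - c| <= f v <= |v - d| - 1] for [c] in [C] and [d] in
[- C] ([scalar_star]). The third condition of the (T)-property says that for
[v] in the sphere the two bounds can be made arbitrarily close: the value
[f v] is determined by distances inside the sphere, which [T] preserves.
Hence, if [h] is a functional of norm at most 1 on [Y] that is 1 on [T C] and
-1 on [T (- C)], then [h (T v) = f v] for every [v] in the sphere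
([sphere_scalar_transport]).

The homogeneous extension [F x = |x| T (x / |x|)] then satisfies [h (F x) = f x]
for every [x], so each [h] kills the linearity defect of [F]. Since the stars
cover the sphere, every unit vector of [Y] is in some [T C], where the
corresponding [h] is 1; no nonzero vector is killed by all the [h], and [F] is
linear. That [F] preserves the norm and is onto is clear from its formula.

Two points need work.

- The functionals exist. For a convex subset [C] of the sphere, the norm is
  additive on the cone over [C], which makes [support_gauge C] sublinear; it is
  1 on [C] and at most the norm. The distance condition forces it to be odd,
  hence linear, so that it is the functional wanted
  ([support_functional]).

- [T C] is the star of [T g] and is convex ([image_star], [convex_star_image]).
  Only distances are controlled by [T], so what is immediate is that [T] sends
  the star of [- x], the points at distance 2 from [x], to the star of
  [- T x]. Thus the star of [T x] depends only on the star of [x], as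
  [- T (- star x)]. If [y] is in [C], every point of the segment from [y] to
  [g] other than [y] has the same star [C] as [g] ([star_segment]), so its
  image lies in the star of [T g]; letting the point tend to [y] gives
  [T y] in the star of [T g]. *)

(** * Convex subsets of the unit sphere *)

Lemma convex_setE (R : realType) (X : normedModType R) (C : set X) :
  @convex_set R X C <->
  forall x y (s t : R), 0 <= s -> 0 <= t -> s + t = 1 -> C x -> C y ->
    C (s *: x + t *: y).
Proof.
split=> [cC x y s t s0 t0 st Cx Cy|cC x y l /set_mem Cx /set_mem Cy].
  have s1 : s <= 1 by lra.
  have := cC x y (Itv01 s0 s1) (mem_set Cx) (mem_set Cy).
  by move/set_mem; rewrite (_ : t = 1 - s)//; lra.
apply/mem_set; apply: (cC x y l%:num (1 - l%:num)) => //.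
by rewrite addrC subrK.
Qed.

Lemma convex_cone_add (R : realType) (X : normedModType R) (C : set X) c d
    (s t : R) :
  @convex_set R X C -> C c -> C d -> 0 <= s -> 0 <= t ->
  exists2 e, C e & s *: c + t *: d = (s + t) *: e.
Proof.
move=> /convex_setE cC Cc Cd s0 t0.
have [st0|st0] := eqVneq (s + t) 0.
  have [-> ->] : s = 0 /\ t = 0 by split; lra.
  by exists c => //; rewrite addr0 !scale0r addr0.
have stp : 0 < s + t by rewrite lt_def st0 addr_ge0.
exists ((s / (s + t)) *: c + (t / (s + t)) *: d).
  apply: cC => //; rewrite ?divr_ge0 ?(ltW stp)//.
  by rewrite -mulrDl divff.
by rewrite scalerDr !scalerA !(mulrC (s + t)) !divfK.
Qed.

Lemma norm_convex_cone (R : realType) (X : normedModType R) (C : set X) c d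
    (s t : R) :
  C `<=` unit_sphere X -> @convex_set R X C -> C c -> C d ->
  0 <= s -> 0 <= t -> `|s *: c + t *: d| = s + t.
Proof.
move=> CS cC Cc Cd s0 t0.
have [e Ce ->] := convex_cone_add cC Cc Cd s0 t0.
by rewrite normrZ (CS _ Ce) mulr1 ger0_norm// addr_ge0.
Qed.

(** * The supporting functional *)

(** [support_gauge C v] is the infimum of [|v + k| - |k|] over the cone generated
    by [C], when [C] lies in the unit sphere. For convex [C] it is an asymptotic
    slope of the norm: the norm is additive on the cone, so the bracket can only
    decrease when an element of the cone is added to [k]. *)
Definition support_values (R : realType) (X : normedModType R) (C : set X)
    (v : X) : set R :=
  [set r | exists t c, [/\ 0 <= t, C c & r = `|v + t *: c| - t]].

Definition support_gauge (R : realType) (X : normedModType R) (C : set X)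
    (v : X) : R :=
  inf (support_values C v).

Lemma le_support_gauge (R : realType) (X : normedModType R) (C : set X)
    (v : X) m :
  C !=set0 ->
  (forall t c, 0 <= t -> C c -> m <= `|v + t *: c| - t) ->
  m <= support_gauge C v.
Proof.
move=> [c0 Cc0] H; apply: lb_le_inf.
  by exists (`|v + 0 *: c0| - 0), 0, c0.
by move=> _ [t [c [t0 Cc ->]]]; exact: H.
Qed.

Lemma support_gauge_le (R : realType) (X : normedModType R) (C : set X)
    (v : X) t c :
  C `<=` unit_sphere X -> 0 <= t -> C c ->
  support_gauge C v <= `|v + t *: c| - t.
Proof.
move=> CS t0 Cc; apply: ge_inf; last by exists t, c.
exists (- `|v|) => _ [s [d [s0 Cd ->]]].
have : `|s *: d| <= `|v + s *: d| + `|v|.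
  by rewrite -(normrN v) (le_trans _ (ler_normD _ _))// addrAC subrr add0r.
by rewrite normrZ (CS _ Cd) mulr1 ger0_norm//; lra.
Qed.

(** Two cone elements [t c] and [s d] that are nearly optimal for [u] and for [v]
    have a sum [(t + s) e] in the cone, of norm [t + s]; the triangle inequality
    then bounds the value of [u + v] there. *)
Lemma support_gaugeD (R : realType) (X : normedModType R) (C : set X)
    (u v : X) :
  C `<=` unit_sphere X -> @convex_set R X C -> C !=set0 ->
  support_gauge C (u + v) <= support_gauge C u + support_gauge C v.
Proof.
move=> CS cC C0; rewrite -lerBlDl; apply: le_support_gauge => // s d s0 Cd.
rewrite lerBlDl -lerBlDr; apply: le_support_gauge => // t c t0 Cc.
have [e Ce E] := convex_cone_add cC Cc Cd t0 s0.
have := support_gauge_le (u + v) CS (addr_ge0 t0 s0) Ce.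
have := ler_normD (u + t *: c) (v + s *: d).
by rewrite addrACA E; lra.
Qed.

Lemma support_gaugeZ_le (R : realType) (X : normedModType R) (C : set X)
    (a : R) (v : X) :
  C `<=` unit_sphere X -> C !=set0 -> 0 < a ->
  support_gauge C (a *: v) <= a * support_gauge C v.
Proof.
move=> CS C0 a0; rewrite -ler_pdivrMl//; apply: le_support_gauge => // t c t0 Cc.
rewrite ler_pdivrMl// mulrBr.
have := support_gauge_le (a *: v) CS (mulr_ge0 (ltW a0) t0) Cc.
by rewrite -scalerA -scalerDr normrZ (gtr0_norm a0).
Qed.

Lemma support_gaugeZ (R : realType) (X : normedModType R) (C : set X)
    (a : R) (v : X) :
  C `<=` unit_sphere X -> C !=set0 -> 0 < a ->
  support_gauge C (a *: v) = a * support_gauge C v.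
Proof.
move=> CS C0 a0; apply/le_anti; rewrite support_gaugeZ_le//=.
have ai0 : 0 < a^-1 by rewrite invr_gt0.
have := support_gaugeZ_le (a *: v) CS C0 ai0.
by rewrite scalerA mulVf ?gt_eqF// scale1r ler_pdivlMl.
Qed.

Lemma support_gauge_le_norm (R : realType) (X : normedModType R) (C : set X)
    (v : X) :
  C `<=` unit_sphere X -> C !=set0 -> support_gauge C v <= `|v|.
Proof.
move=> CS [c Cc]; have := support_gauge_le v CS (lexx 0) Cc.
by rewrite scale0r addr0 subr0.
Qed.

Lemma support_gauge0 (R : realType) (X : normedModType R) (C : set X) :
  C `<=` unit_sphere X -> C !=set0 -> support_gauge C 0 = 0.
Proof.
move=> CS C0; apply/le_anti/andP; split.
  by rewrite -[leRHS](normr0 X) support_gauge_le_norm.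
apply: le_support_gauge => // t c t0 Cc.
by rewrite add0r normrZ (CS _ Cc) mulr1 ger0_norm// subrr.
Qed.

(** The norm is additive on the cone over [C], so [|c + t d| - t = 1] for all [t]
    and [d]. *)
Lemma support_gauge1 (R : realType) (X : normedModType R) (C : set X) c :
  C `<=` unit_sphere X -> @convex_set R X C -> C c -> support_gauge C c = 1.
Proof.
move=> CS cC Cc; have C0 : C !=set0 by exists c.
apply/le_anti/andP; split.
  by have := support_gauge_le_norm c CS C0; rewrite (CS _ Cc).
apply: le_support_gauge => // t d t0 Cd.
by have := norm_convex_cone CS cC Cc Cd ler01 t0; rewrite scale1r => ->; lra.
Qed.

(** Every unit vector has distances to [C] and to [- C] of sum at most 2, which
    is the least possible sum when some functional of norm 1 equals 1 on [C].
    Writing the point of [- C] as [- d] keeps the condition within [C]. *)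
Definition nearly_bisecting (R : realType) (X : normedModType R) (C : set X) :=
  forall x (e : R), unit_sphere X x -> 0 < e ->
    exists c d, [/\ C c, C d & `|x - c| + `|x + d| <= 2 + e].

Lemma unit_sphere_normalize (R : realType) (X : normedModType R) (v : X) :
  v != 0 -> unit_sphere X (`|v|^-1 *: v).
Proof. by move=> v0; rewrite /unit_sphere/= normrZ normfV normr_id mulVf ?normr_eq0. Qed.

(** Subadditivity gives one inequality. For the other, a unit vector [x] with
    points [c] of [C] and [- d] of [- C] as in [nearly_bisecting] has gauge at
    most [|x + d| - 1], and [- x] has gauge at most [|x - c| - 1]. *)
Lemma support_gaugeN (R : realType) (X : normedModType R) (C : set X) v :
  C `<=` unit_sphere X -> @convex_set R X C -> C !=set0 ->
  nearly_bisecting C -> support_gauge C (- v) = - support_gauge C v.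
Proof.
move=> CS cC C0 bC.
have [->|v0] := eqVneq v 0; first by rewrite oppr0 support_gauge0// oppr0.
apply/eqP; rewrite -addr_eq0 eq_le; apply/andP; split; last first.
  by rewrite -(support_gauge0 CS C0) -(addNr v) support_gaugeD.
have nv0 : 0 < `|v| by rewrite normr_gt0.
rewrite -(pmulr_rle0 _ (_ : 0 < `|v|^-1)) ?invr_gt0// mulrDr.
rewrite -!support_gaugeZ ?invr_gt0// scalerN.
have := unit_sphere_normalize v0; move: (_ *: v) => x Sx.
apply/ler_addgt0Pl => e e0; rewrite addr0.
have [c [d [Cc Cd]]] := bC x e Sx e0.
have := support_gauge_le (- x) CS ler01 Cc.
have := support_gauge_le x CS ler01 Cd.
by rewrite !scale1r -(normrN (x - c)) opprB (addrC c); lra.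
Qed.

Lemma support_functional (R : realType) (X : normedModType R) (C : set X) :
  C `<=` unit_sphere X -> @convex_set R X C -> C !=set0 ->
  nearly_bisecting C ->
  exists f : {scalar X},
    (forall v, f v <= `|v|) /\ (forall c, C c -> f c = 1).
Proof.
move=> CS cC C0 bC; set f := support_gauge C.
have fN v : f (- v) = - f v by exact: support_gaugeN.
have fD u v : f (u + v) = f u + f v.
  apply/le_anti; rewrite support_gaugeD//=.
  have := support_gaugeD (- u) (- v) CS cC C0.
  by rewrite -opprD -/f !fN; lra.
have fZ a v : f (a *: v) = a * f v.
  have [a0|a0|->] := ltgtP a 0.
  - by rewrite -[a]opprK scaleNr fN mulNr /f support_gaugeZ// oppr_gt0.
  - exact: support_gaugeZ.
  - by rewrite scale0r mul0r /f support_gauge0.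
have fL : scalar f by move=> a u v; rewrite fD fZ.
pose F : {scalar X} := HB.pack f (GRing.isLinear.Build _ _ _ _ f fL).
exists F; split=> [v|c Cc]; first exact: support_gauge_le_norm.
exact: support_gauge1.
Qed.

(** * Stars *)

Lemma starN (R : realType) (X : normedModType R) (x y : X) :
  star (- x) y <-> star x (- y).
Proof.
by rewrite /star /unit_sphere /= normrN -(normrN (y - x)) opprB addrC.
Qed.

Lemma star_id (R : realType) (X : normedModType R) (x : X) :
  unit_sphere X x -> star x x.
Proof.
by move=> Sx; split=> //; rewrite -mulr2n -scaler_nat normrZ Sx mulr1 normr_nat.
Qed.

Lemma star_of_norm_ge2 (R : realType) (X : normedModType R) (x y : X) :
  `|x| <= 1 -> `|y| <= 1 -> 2 <= `|y + x| -> star x y.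
Proof.
by move=> x1 y1 yx; have := ler_normD y x; split; rewrite /unit_sphere/=; lra.
Qed.

Lemma norm_conv_le1 (R : realType) (X : normedModType R) (x y : X) (s t : R) :
  `|x| <= 1 -> `|y| <= 1 -> 0 <= s -> 0 <= t -> s + t = 1 ->
  `|s *: x + t *: y| <= 1.
Proof.
move=> x1 y1 s0 t0 <-; rewrite (le_trans (ler_normD _ _))// !normrZ !ger0_norm//.
by rewrite lerD// ler_piMr.
Qed.

(** If a convex combination has full distance 2 from [- z], so has each point
    that enters it with positive weight: the norm of the sum is an average of
    two numbers at most 2. *)
Lemma star_conv_sub (R : realType) (X : normedModType R) (x y : X) (s t : R) :
  `|x| <= 1 -> `|y| <= 1 -> 0 <= s -> 0 < t -> s + t = 1 ->
  star (s *: y + t *: x) `<=` star x.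
Proof.
move=> x1 y1 s0 t0 st z [Sz zE].
apply: star_of_norm_ge2 => //; first by rewrite Sz.
have := ler_normD (s *: (z + y)) (t *: (z + x)).
rewrite !scalerDr addrACA -scalerDl st scale1r zE.
rewrite -!scalerDr !normrZ (ger0_norm s0) (gtr0_norm t0) => H.
have : `|z + y| <= 2 by rewrite (le_trans (ler_normD _ _))// Sz; lra.
by nra.
Qed.

Lemma convex_sub_star (R : realType) (X : normedModType R) (C : set X) y :
  C `<=` unit_sphere X -> @convex_set R X C -> C y -> C `<=` star y.
Proof.
move=> CS cC Cy z Cz; split; first exact: CS.
by have := norm_convex_cone CS cC Cz Cy ler01 ler01; rewrite !scale1r.
Qed.

(** The combinations with weights [(s, t)] and [(t, s)] have sum [x + y], of norm
    2, so neither can be inside the ball. *)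
Lemma star_segment_sphere (R : realType) (X : normedModType R) (x y : X)
    (s t : R) :
  unit_sphere X x -> star x y -> 0 <= s -> 0 <= t -> s + t = 1 ->
  unit_sphere X (s *: y + t *: x).
Proof.
move=> Sx [Sy yx] s0 t0 st; have st' : t + s = 1 by rewrite addrC.
apply/le_anti; rewrite norm_conv_le1 ?Sx ?Sy//=.
have := ler_normD (s *: y + t *: x) (t *: y + s *: x).
rewrite addrACA -!scalerDl st (addrC t) st !scale1r yx.
have : `|t *: y + s *: x| <= 1 by rewrite norm_conv_le1 ?Sx ?Sy.
by lra.
Qed.

Lemma star_sub_sphere (R : realType) (X : normedModType R) (x : X) :
  star x `<=` unit_sphere X.
Proof. by move=> y []. Qed.

(** Used to let the point [s y + t x] tend to [y], at distance at most [2 t]. *)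
Lemma ler_segment_limit (R : realType) (a b : R) :
  (forall s t, 0 <= s -> 0 < t -> s + t = 1 -> a <= b + t * 2) -> a <= b.
Proof.
move=> H; apply/ler_addgt0Pr => e e0.
have [e2|e2] := leP e 2.
  by have := H (1 - e / 2) (e / 2); rewrite divfK//; apply; lra.
by have := H 0 1; lra.
Qed.

Lemma norm_segment_dist (R : realType) (X : normedModType R) (x y : X)
    (s t : R) :
  unit_sphere X x -> unit_sphere X y -> 0 < t -> s + t = 1 ->
  `|s *: y + t *: x - y| <= t * 2.
Proof.
move=> Sx Sy t0 st; have -> : s = 1 - t by lra.
rewrite scalerBl scale1r (_ : _ - y = t *: (x - y)); last first.
  by rewrite scalerBr addrAC (addrAC y) subrr add0r addrC.
rewrite normrZ gtr0_norm// ler_pM2l// (le_trans (ler_normB _ _))// Sx Sy; lra.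
Qed.

(** * Stars under an isometry of spheres *)

Definition sphere_isometry (R : realType) (X Y : normedModType R)
    (T : X -> Y) :=
  [/\ set_fun (unit_sphere X) (unit_sphere Y) T,
      set_surj (unit_sphere X) (unit_sphere Y) T &
      isometry_on (unit_sphere X) T].

(** The star of [- x] is the set of unit vectors at distance 2 from [x]. *)
Lemma star_antipode_image (R : realType) (X Y : normedModType R) (T : X -> Y)
    (x y : X) :
  sphere_isometry T -> unit_sphere X x -> unit_sphere X y ->
  star (- x) y <-> star (- T x) (T y).
Proof.
move=> [TS _ TI] Sx Sy; split=> -[_ E]; split=> //; first exact: TS.
- by rewrite TI.
- by rewrite -TI.
Qed.

(** The star of [T x] is [- T (- star x)]: an element [w] is [- T u] for some [u],
    and [w] is in it exactly when [u] is at distance 2 from [x]. Hence it is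
    monotone in the star of [x]. *)
Lemma star_image_sub (R : realType) (X Y : normedModType R) (T : X -> Y)
    (x y : X) :
  sphere_isometry T -> unit_sphere X x -> unit_sphere X y ->
  star x `<=` star y -> star (T x) `<=` star (T y).
Proof.
move=> isoT Sx Sy xy w xw; have [_ TO _] := isoT.
have Sw : unit_sphere Y (- w) by rewrite /unit_sphere/= normrN; case: xw.
have [u Su Eu] := TO _ Sw; move: xw; rewrite -(opprK w) => /starN.
rewrite -Eu => /(star_antipode_image isoT Sx Su) /starN /xy /starN.
by move=> /(star_antipode_image isoT Sy Su) /starN.
Qed.

(** When the star of [x] is convex, the points having that same star are dense in
    it: convexity puts the whole star of [x] in the star of each of its points,
    and a combination involving [x] has no larger star than [x]. *)
Lemma star_segment (R : realType) (X : normedModType R) (x y : X) (s t : R) :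
  unit_sphere X x -> @convex_set R X (star x) -> star x y ->
  0 <= s -> 0 < t -> s + t = 1 ->
  star x (s *: y + t *: x) /\ star (s *: y + t *: x) = star x.
Proof.
move=> Sx cx xy s0 t0 st.
have xz : star x (s *: y + t *: x).
  by have /convex_setE := cx; apply=> //; [exact: ltW|exact: star_id].
split=> //; apply/seteqP; split.
  by apply: star_conv_sub => //; [rewrite Sx|case: xy => ->].
by apply: convex_sub_star => //; exact: star_sub_sphere.
Qed.

(** A point [z] of the segment close to [y] has the star of [x], so [T z] has the
    star of [T x], which therefore contains [T z]. Stars are closed, and [T z]
    tends to [T y]. *)
Lemma image_star_sub (R : realType) (X Y : normedModType R) (T : X -> Y)
    (x y : X) :
  sphere_isometry T -> unit_sphere X x -> @convex_set R X (star x) ->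
  star x y -> star (T x) (T y).
Proof.
move=> isoT Sx cx xy; have [TS _ TI] := isoT; have [Sy _] := xy.
apply: star_of_norm_ge2; rewrite ?(TS _ Sx) ?(TS _ Sy)//.
apply: ler_segment_limit => s t s0 t0 st.
have [[Sz _] zE] := star_segment Sx cx xy s0 t0 st.
have zle := norm_segment_dist Sx Sy t0 st.
move: Sz zE zle; set z := _ + _ => Sz zE zle.
have [_ zx2] : star (T x) (T z).
  have zx : star z `<=` star x by rewrite zE.
  by apply: (star_image_sub isoT Sz Sx zx); exact/star_id/TS.
rewrite -[leLHS]zx2 (le_trans _ (lerD (lexx _) zle))// -TI// [leRHS]addrC.
by rewrite (le_trans _ (ler_normD _ _))// addrA addrNK.
Qed.

Lemma convex_starN (R : realType) (X : normedModType R) (x : X) :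
  @convex_set R X (star x) -> @convex_set R X (star (- x)).
Proof.
move=> /convex_setE cx; apply/convex_setE => u v s t s0 t0 st.
rewrite !starN opprD -!scalerN; exact: cx.
Qed.

(** For the converse, [T y] in the star of [T x] means that [- T y = T u] with [u]
    at distance 2 from [x]; then the direct implication, applied to [- x] and
    [u], says that [T u] is in the star of [T (- x)], that is, [T y] and
    [T (- x)] are at distance 2, and so are [y] and [- x]. *)
Lemma image_star (R : realType) (X Y : normedModType R) (T : X -> Y)
    (x y : X) :
  sphere_isometry T -> unit_sphere X x -> @convex_set R X (star x) ->
  unit_sphere X y -> star x y <-> star (T x) (T y).
Proof.
move=> isoT Sx cx Sy; have [TS TO _] := isoT.
split=> [|xy]; first exact: image_star_sub.
have SNx : unit_sphere X (- x) by rewrite /unit_sphere/= normrN.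
have SNTy : unit_sphere Y (- T y) by rewrite /unit_sphere/= normrN; exact: TS.
have [u Su Eu] := TO _ SNTy.
have xu : star (- x) u.
  by apply/(star_antipode_image isoT) => //; rewrite Eu starN opprK.
have := image_star_sub isoT SNx (convex_starN cx) xu.
rewrite Eu -starN -star_antipode_image// opprK; exact.
Qed.

(** Replace [d] by a nearby point [z] of the segment from [d] to [p = T x]. Its
    star is that of [p]: one inclusion is [star_conv_sub], the other holds
    because [z] is the image of a point of the convex star of [x]. A combination
    [m] of [z], with positive weight, and [d'] is a unit vector, since [d'] is in the star of [z], and
    its star, to which it belongs, is contained in that of [z]. So [m] is in the
    star of [p], which is closed. *)
Lemma convex_star_image (R : realType) (X Y : normedModType R) (T : X -> Y)
    (x : X) :
  sphere_isometry T -> unit_sphere X x -> @convex_set R X (star x) ->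
  @convex_set R Y (star (T x)).
Proof.
move=> isoT Sx cx; have [TS TO _] := isoT.
set p := T x; have Sp : unit_sphere Y p by exact: TS.
apply/convex_setE => d d' a b a0 b0 ab pd pd'.
have [Sd _] := pd; have [Sd' _] := pd'.
have [a00|a00] := eqVneq a 0.
  by rewrite (_ : b = 1) ?a00 ?scale0r ?add0r ?scale1r//; lra.
have ap : 0 < a by rewrite lt_def a00.
apply: star_of_norm_ge2; rewrite ?norm_conv_le1 ?Sp ?Sd ?Sd'//.
apply: ler_segment_limit => s t s0 t0 st.
set z := s *: d + t *: p.
have zp : star z `<=` star p by apply: star_conv_sub; rewrite ?Sp ?Sd.
have Sz : unit_sphere Y z.
  by apply: star_segment_sphere => //; exact: ltW.
have [w Sw wz] := TO _ Sz.
have pz : star p `<=` star z.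
  rewrite -wz; apply: star_image_sub => //; apply: convex_sub_star => //.
    exact: star_sub_sphere.
  by apply/(image_star isoT) => //; rewrite wz; exact/zp/star_id.
have zd' : star z d' by exact: pz.
pose m := b *: d' + a *: z.
have pm : star p m.
  have ba : b + a = 1 by rewrite addrC.
  have d'1 : `|d'| <= 1 by rewrite Sd'.
  have z1 : `|z| <= 1 by rewrite Sz.
  apply/zp/(star_conv_sub z1 d'1 b0 ap ba).
  by apply/star_id/star_segment_sphere.
have [_ pm2] := pm.
have mle : `|m - (a *: d + b *: d')| <= t * 2.
  have -> : m - (a *: d + b *: d') = a *: (z - d).
    by rewrite /m [a *: d + _]addrC opprD addrACA subrr add0r scalerBr.
  have := norm_segment_dist Sp Sd t0 st.
  rewrite normrZ gtr0_norm// -/z; apply: le_trans.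
  by rewrite ler_piMl//; lra.
rewrite -[leLHS]pm2 (le_trans _ (lerD (lexx _) mle))// [leRHS]addrC.
by rewrite (le_trans _ (ler_normD _ _))// addrA addrNK.
Qed.

(** * Linear extension *)

Lemma nearly_bisecting_star_image (R : realType) (X Y : normedModType R)
    (T : X -> Y) (x : X) :
  sphere_isometry T -> unit_sphere X x -> @convex_set R X (star x) ->
  nearly_bisecting (star x) -> nearly_bisecting (star (T x)).
Proof.
move=> isoT Sx cx bx; have [TS TO TI] := isoT.
move=> _ e /TO [u Su <-] e0.
have [c [d [xc xd cd]]] := bx u e Su e0.
have [Sc _] := xc.
have xNd : star (- x) (- d) by rewrite starN opprK.
have [SNd _] := xNd.
exists (T c), (- T (- d)); split; first exact/(image_star isoT).
  by apply/starN/(star_antipode_image isoT).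
by rewrite !TI// opprK.
Qed.

(** The value at [v] of a functional supporting the star of [x] is squeezed by the
    distances from [v] to the stars of [x] and of [- x]. *)
Lemma scalar_star (R : realType) (X : normedModType R) (x v : X)
    (f : {scalar X}) :
  (forall v, f v <= `|v|) -> (forall c, star x c -> f c = 1) ->
  forall c d, star x c -> star (- x) d ->
  1 - `|v - c| <= f v /\ f v <= `|v - d| - 1.
Proof.
move=> fle f1 c d xc /starN xd; split.
  by have := fle (c - v); rewrite raddfB/= (f1 c xc) distrC; lra.
by have := fle (v + - d); rewrite raddfD/= (f1 _ xd); lra.
Qed.

(** [f u] and [h (T u)] lie in the same interval, whose length is arbitrarily
    small, because [T] preserves the distances that bound it. *)
Lemma sphere_scalar_transport (R : realType) (X Y : normedModType R)
    (T : X -> Y) (x : X) :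
  sphere_isometry T -> unit_sphere X x -> @convex_set R X (star x) ->
  nearly_bisecting (star x) ->
  exists (f : {scalar X}) (h : {scalar Y}),
    [/\ forall v, h v <= `|v|,
        forall c, star (T x) c -> h c = 1 &
        forall u, unit_sphere X u -> h (T u) = f u].
Proof.
move=> isoT Sx cx bx; have [TS TO TI] := isoT.
have ne (V : normedModType R) (v : V) : unit_sphere V v -> star v !=set0.
  by move=> Sv; exists v; exact: star_id.
have [f [fle f1]] := support_functional (@star_sub_sphere _ _ x) cx (ne _ _ Sx) bx.
have [h [hle h1]] := support_functional (@star_sub_sphere _ _ (T x))
  (convex_star_image isoT Sx cx) (ne _ _ (TS _ Sx))
  (nearly_bisecting_star_image isoT Sx cx bx).
exists f, h; split=> // u Su.
apply/eqP; rewrite -subr_eq0 -normr_le0; apply/ler_addgt0Pl => e e0; rewrite addr0.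
have [c [d [xc xd cd]]] := bx u e Su e0.
have xNd : star (- x) (- d) by rewrite starN opprK.
have [Sc _] := xc; have [SNd _] := xNd.
have [] := scalar_star u fle f1 xc xNd.
have [] := scalar_star (T u) hle h1 (image_star_sub isoT Sx cx xc)
  (iffLR (star_antipode_image isoT Sx SNd) xNd).
rewrite !TI// opprK ler_norml; lra.
Qed.

Definition homogeneous_extension (R : realType) (X Y : normedModType R)
    (T : X -> Y) (x : X) : Y :=
  `|x| *: T (`|x|^-1 *: x).

Lemma homogeneous_extension_sphere (R : realType) (X Y : normedModType R)
    (T : X -> Y) (x : X) :
  unit_sphere X x -> homogeneous_extension T x = T x.
Proof. by move=> Sx; rewrite /homogeneous_extension Sx invr1 !scale1r. Qed.

Lemma norm_homogeneous_extension (R : realType) (X Y : normedModType R)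
    (T : X -> Y) (x : X) :
  set_fun (unit_sphere X) (unit_sphere Y) T ->
  `|homogeneous_extension T x| = `|x|.
Proof.
move=> TS; rewrite normrZ normr_id.
have [->|x0] := eqVneq x 0; first by rewrite normr0 mul0r.
by rewrite (TS _ (unit_sphere_normalize x0)) mulr1.
Qed.

Lemma homogeneous_extension_surj (R : realType) (X Y : normedModType R)
    (T : X -> Y) :
  set_surj (unit_sphere X) (unit_sphere Y) T ->
  set_surj [set: X] [set: Y] (homogeneous_extension T).
Proof.
move=> TO y _.
have [->|y0] := eqVneq y 0.
  by exists 0 => //; rewrite /homogeneous_extension normr0 scale0r.
have [u Su Eu] := TO _ (unit_sphere_normalize y0).
have ny0 : `|y| != 0 by rewrite normr_eq0.
exists (`|y| *: u) => //; rewrite /homogeneous_extension normrZ Su normr_id mulr1.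
by rewrite scalerA mulVf// scale1r Eu scalerA divff// scale1r.
Qed.

Lemma scalar_homogeneous_extension (R : realType) (X Y : normedModType R)
    (T : X -> Y) (f : {scalar X}) (h : {scalar Y}) (x : X) :
  (forall u, unit_sphere X u -> h (T u) = f u) ->
  h (homogeneous_extension T x) = f x.
Proof.
move=> hf; have [->|x0] := eqVneq x 0.
  by rewrite /homogeneous_extension normr0 scale0r !raddf0.
rewrite linearZ/= hf ?linearZ/= ?mulrA ?divff ?mul1r ?normr_eq0//.
exact: unit_sphere_normalize.
Qed.

Theorem theorem2p5 (R : realType) (X Y : completeNormedModType R) (T : X -> Y)
    (T_maps : set_fun (unit_sphere X) (unit_sphere Y) T)
    (T_surj : set_surj (unit_sphere X) (unit_sphere Y) T)
    (T_isom : isometry_on (unit_sphere X) T)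
    (X_T : T_property X) :
  exists F : {linear X -> Y},
    [/\ isometry_on [set: X] F,
        set_surj [set: X] [set: Y] F &
        forall x, unit_sphere X x -> F x = T x].
Proof.
have isoT : sphere_isometry T by split.
have [G [GS Gmax Gcover Gbis]] := X_T.
have transport g : G g -> exists (f : {scalar X}) (h : {scalar Y}),
    [/\ forall v, h v <= `|v|,
        forall c, star (T g) c -> h c = 1 &
        forall u, unit_sphere X u -> h (T u) = f u].
  move=> Gg; have [_ cg _] := Gmax g Gg.
  apply: sphere_scalar_transport => //; first exact: GS.
  move=> x e Sx e0; have [c [d [gc /starN gd cd]]] := Gbis x g e Sx Gg e0.
  by exists c, (- d); split.
pose F := homogeneous_extension T.
have FL : linear F.
  (* A nonzero defect [z] would, once normalized, lie in the image of some star,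
     where the corresponding functional is 1 although it vanishes at [z]. *)
  move=> a x y; apply/eqP; rewrite -subr_eq0; apply: contraT => z0.
  set z := _ - _ in z0.
  have [u Su Eu] := T_surj _ (unit_sphere_normalize z0).
  have := Su; rewrite Gcover => -[g Gg gu].
  have [f [h [_ h1 hf]]] := transport g Gg.
  have [_ cg _] := Gmax g Gg.
  have := h1 _ (image_star_sub isoT (GS _ Gg) cg gu).
  have hz : h z = 0.
    rewrite /z raddfB/= linearP/= !(scalar_homogeneous_extension _ hf).
    by rewrite linearP/= subrr.
  by rewrite Eu linearZ/= hz mulr0 => /esym/eqP; rewrite oner_eq0.
pose Fl : {linear X -> Y} := HB.pack F (GRing.isLinear.Build _ _ _ _ F FL).
exists Fl; split.
- by move=> x y _ _; rewrite -linearB; exact: norm_homogeneous_extension.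
- exact: homogeneous_extension_surj.
- by move=> x Sx; exact: homogeneous_extension_sphere.
Qed.
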